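(* Let $d\in\mathbb{N}$. The following are equivalent: (i) For every $\ell\le d$ and every non-hollow lattice $\ell$-polytope $P\subseteq\mathbb{R}^\ell$ we have $\mu(P,\mathbb{Z}^\ell)\le \frac{\ell}{2}$. (ii) For all $\ell,n\in\mathbb{N}$ with $\ell\le d\le n$ we have $\mu_\ell(S(\mathbf{1}_{n+1}),\mathbb{Z}^n)=\frac{\ell}{2}$.
   Context: For a convex body $K\subseteq\mathbb{R}^d$ and a lattice $\Lambda\subseteq\mathbb{R}^d$, the covering radius is $\mu(K,\Lambda)=\min\{\mu\ge0:\mu K+\Lambda=\mathbb{R}^d\}$. A lattice polytope is one whose vertices lie in $\mathbb{Z}^d$; it is non-hollow if its interior contains a point of $\mathbb{Z}^d$. For a convex body $K\subseteq\mathbb{R}^n$, a lattice $\Lambda\subseteq\mathbb{R}^n$ and $\ell\le n$, the $\ell$-th covering minimum is $\mu_\ell(K,\Lambda)=\max_\pi \mu(\pi(K),\pi(\Lambda))$, where $\pi$ ranges over linear projections $\mathbb{R}^n\to\mathbb{R}^\ell$ such that $\pi(\Lambda)$ is a lattice. $\mathbf{1}_n=(1,\dots,1)\in\mathbb{R}^n$, $e_i$ are the standard unit vectors, and $S(\mathbf{1}_{n+1})=\operatorname{conv}\{-\mathbf{1}_n,e_1,\dots,e_n\}\subseteq\mathbb{R}^n$. *)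

(* Defs.v *)
From HB Require Import structures.
From mathcomp Require Import all_boot all_order all_algebra.
From mathcomp Require Import all_classical all_reals all_analysis.

Set Implicit Arguments.
Unset Strict Implicit.
Unset Printing Implicit Defensive.

Import Order.TTheory GRing.Theory Num.Theory.
Import numFieldNormedType.Exports.

Local Open Scope classical_set_scope.
Local Open Scope ring_scope.

(* Points of R^n are row vectors 'rV[R]_n. *)

Definition is_minimum (R : realType) (A : set R) (m : R) : Prop :=
  A m /\ lbound A m.

Definition is_maximum (R : realType) (A : set R) (m : R) : Prop :=
  A m /\ ubound A m.

Definition convex_hull (R : realType) (n : nat) (A : set 'rV[R]_n) : set 'rV[R]_n :=
  smallest (@convex_set R 'rV[R]_n) A.

Definition int_lattice (R : realType) (n : nat) : set 'rV[R]_n :=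
  [set x | forall i, x 0 i \is a Num.int].

Arguments int_lattice : clear implicits.

(* Lattices have full rank: L is the set of integer combinations of the rows
   of an invertible matrix, i.e. of a basis of R^n. *)
Definition is_lattice (R : realType) (n : nat) (L : set 'rV[R]_n) : Prop :=
  exists2 B : 'M[R]_n, B \in unitmx & L = [set x *m B | x in int_lattice R n].

(* mu K + L = R^n *)
Definition covers (R : realType) (n : nat) (K L : set 'rV[R]_n) (mu : R) : Prop :=
  [set mu *: p + z | p in K & z in L] = setT.

(* mu(K, L) = m, as a relation: no default value is needed for pairs (K, L)
   for which the minimum does not exist. *)
Definition is_covering_radius (R : realType) (n : nat) (K L : set 'rV[R]_n)
    (m : R) : Prop :=
  is_minimum [set mu | 0 <= mu /\ covers K L mu] m.

(* mu_l(K, L) = m *)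
Definition is_covering_minimum (R : realType) (n l : nat)
    (K L : set 'rV[R]_n) (m : R) : Prop :=
  is_maximum
    [set mu | exists f : {linear 'rV[R]_n -> 'rV[R]_l},
       [/\ range f = setT, is_lattice (f @` L)
         & is_covering_radius (f @` K) (f @` L) mu]] m.

Definition is_polytope (R : realType) (n : nat) (P : set 'rV[R]_n) : Prop :=
  exists2 V : set 'rV[R]_n, finite_set V & P = convex_hull V.

(* The vertices of a polytope are its extreme points. *)
Definition vertices (R : realType) (n : nat) (P : set 'rV[R]_n) :
    set 'rV[R]_n :=
  [set v | P v /\ forall (x y : 'rV[R]_n) (t : R), P x -> P y -> 0 < t < 1 ->
             v = t *: x + (1 - t) *: y -> x = v /\ y = v].

Definition lattice_polytope (R : realType) (n : nat) (P : set 'rV[R]_n) : Prop :=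
  is_polytope P /\ vertices P `<=` int_lattice R n.

(* In R^n this forces P to have nonempty interior, so a non-hollow polytope
   in R^n automatically has dimension n. *)
Definition non_hollow (R : realType) (n : nat) (P : set 'rV[R]_n) : Prop :=
  (P° `&` int_lattice R n) !=set0.

(* S(1_{n+1}) = conv {-1_n, e_1, ..., e_n} *)
Definition S1 (R : realType) (n : nat) : set 'rV[R]_n :=
  convex_hull ([set const_mx (-1)] `|` range (fun i : 'I_n => delta_mx 0 i)).

Arguments S1 : clear implicits.

(* Main.v *)
(** (i) => (ii): in lattice coordinates the image of S(1_{n+1}) under an
    admissible projection is a lattice polytope with 0 in its interior, so (i)
    bounds its covering radius by l/2.  Forgetting the last n - l coordinates
    attains l/2: the point (1/(l+1), ..., l/(l+1)) is not covered by any
    smaller dilate.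

    (ii) => (i): translate an interior lattice point of P to 0.  Then some
    positive integer combination of the vertices of P vanishes; repeating every
    vertex according to its coefficient gives n + 1 lattice points with sum 0,
    with n as large as we like.  The linear map sending e_1, ..., e_n to n of
    them sends -1_n to the last one, hence S(1_{n+1}) into P and Z^n onto a
    sublattice of Z^l, which can only increase the covering radius. *)

Require Import Defs.
From HB Require Import structures.
From mathcomp Require Import all_boot all_order all_algebra.
From mathcomp Require Import all_classical all_reals all_analysis.
From mathcomp Require Import ring lra zify.

Import Order.TTheory GRing.Theory Num.Theory.
Import numFieldNormedType.Exports.

Local Open Scope classical_set_scope.
Local Open Scope ring_scope.

Set Implicit Arguments.
Unset Strict Implicit.
Unset Printing Implicit Defensive.

(** * Convex hulls of the rows of a matrix *)

Definition weights (R : realType) (m : nat) : set 'rV[R]_m :=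
  [set w | (forall i, 0 <= w 0 i) /\ \sum_i w 0 i = 1].

Arguments weights : clear implicits.

(** Generators are the rows of a matrix, so linear maps act by right multiplication and generators
    may repeat; [convex_hull_rows] identifies this set with [convex_hull]. *)
Definition hull (R : realType) (m n : nat) (V : 'M[R]_(m, n)) : set 'rV[R]_n :=
  [set w *m V | w in weights R m].

Section Hull.
Variable R : realType.
Implicit Types m n k : nat.

Lemma weights_comb m (t : R) (u v : 'rV[R]_m) : 0 <= t <= 1 ->
  weights R m u -> weights R m v -> weights R m (t *: u + (1 - t) *: v).
Proof.
move=> /andP[t0 t1] [u0 u1] [v0 v1]; split=> [i|].
  by rewrite !mxE addr_ge0 ?mulr_ge0 ?subr_ge0.
under eq_bigr do rewrite !mxE.
by rewrite big_split /= -!mulr_sumr u1 v1 !mulr1 addrC subrK.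
Qed.

Lemma weights_delta m (i : 'I_m) : weights R m (delta_mx 0 i).
Proof.
split=> [j|]; first by rewrite mxE ler0n.
rewrite (bigD1 i) //= mxE !eqxx big1 ?addr0// => j ji.
by rewrite mxE eqxx (negbTE ji).
Qed.

Lemma weights_mulmx m k (w : 'rV[R]_m) (U : 'M[R]_(m, k)) :
  weights R m w -> (forall i, weights R k (row i U)) -> weights R k (w *m U).
Proof.
move=> [w0 w1] U01; split=> [j|].
  rewrite mxE; apply: sumr_ge0 => i _; apply: mulr_ge0 => //.
  by have [/(_ j)] := U01 i; rewrite mxE.
under eq_bigr do rewrite mxE.
rewrite exchange_big /= -[RHS]w1; apply: eq_bigr => i _.
rewrite -mulr_sumr -[RHS]mulr1; congr (_ * _).
by have [_ <-] := U01 i; apply: eq_bigr => j _; rewrite mxE.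
Qed.

Lemma weights_eq1 m (w : 'rV[R]_m) i :
  weights R m w -> w 0 i = 1 -> w = delta_mx 0 i.
Proof.
move=> [w0 w1] wi; apply/rowP => j; rewrite mxE eqxx /=.
have [->//|ji] := eqVneq j i.
move: w1; rewrite (bigD1 i) //= wi => /eqP.
rewrite -subr_eq0 addrAC subrr add0r => /eqP s0.
by apply: (psumr_eq0P _ s0).
Qed.

Lemma weights_le1 m (w : 'rV[R]_m) i : weights R m w -> w 0 i <= 1.
Proof.
by move=> [w0 <-]; rewrite (bigD1 i) //= lerDl sumr_ge0.
Qed.

(** The weights other than [w 0 i] are rescaled by [(1 - w 0 i)^-1]. Peeling off one row this way
    drives the inductions and the extreme-point arguments below. *)
Lemma weights_split m n (w : 'rV[R]_m.+1) (V : 'M[R]_(m.+1, n)) i :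
  weights R m.+1 w -> w 0 i != 1 ->
  exists2 u, weights R m u &
    w *m V = w 0 i *: row i V + (1 - w 0 i) *: (u *m row' i V).
Proof.
move=> ww wi1; have [w0 w1] := ww.
have wi_lt : 0 < 1 - w 0 i by rewrite subr_gt0 lt_neqAle wi1 weights_le1.
have wi_neq := lt0r_neq0 wi_lt.
exists ((1 - w 0 i)^-1 *: col' i w).
  split=> [j|]; first by rewrite !mxE mulr_ge0 ?invr_ge0 ?(ltW wi_lt).
  under eq_bigr do rewrite !mxE.
  rewrite -mulr_sumr; apply: (canLR (mulKf wi_neq)).
  by rewrite mulr1 -w1 (bigD1_ord i) //= addrAC subrr add0r.
apply/rowP => j; rewrite !mxE (bigD1_ord i) //= mulr_sumr; congr (_ + _).
by apply: eq_bigr => k _; rewrite !mxE mulrA mulVKf.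
Qed.

Lemma hull_row m n (V : 'M[R]_(m, n)) i : hull V (row i V).
Proof. by exists (delta_mx 0 i); [exact: weights_delta | rewrite -rowE]. Qed.

Lemma hull_sub m k n (V : 'M[R]_(m, n)) (W : 'M[R]_(k, n)) :
  (forall i, hull W (row i V)) -> hull V `<=` hull W.
Proof.
move=> hV _ [w ww <-].
have /choice[u uP] i : exists u, weights R k u /\ u *m W = row i V.
  by have [u uw uV] := hV i; exists u.
pose U := \matrix_i u i.
have -> : V = U *m W.
  by apply/row_matrixP => i; rewrite row_mul rowK; case: (uP i) => _ ->.
rewrite mulmxA; exists (w *m U) => //; apply: weights_mulmx => // i.
by rewrite rowK; case: (uP i).
Qed.

Lemma hull_mulmx m n k (V : 'M[R]_(m, n)) (F : 'M[R]_(n, k)) :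
  [set x *m F | x in hull V] = hull (V *m F).
Proof.
apply/seteqP; split=> [_ [_ [w ww <-] <-]|_ [w ww <-]].
  by rewrite -mulmxA; exists w.
by rewrite mulmxA; exists (w *m V) => //; exists w.
Qed.

Lemma convex_set_hull m n (V : 'M[R]_(m, n)) (C : set 'rV[R]_n) :
  @convex_set R 'rV[R]_n C -> (forall i, C (row i V)) -> hull V `<=` C.
Proof.
move=> cC; elim: m V => [|m IHm] V CV _ [w ww <-].
  by have [_ /eqP] := ww; rewrite big_ord0 eq_sym oner_eq0.
have [wi1|wi1] := eqVneq (w 0 0) 1.
  by rewrite (weights_eq1 ww wi1) -rowE.
have [u uw ->] := weights_split V ww wi1.
have w01 : (0 <= w 0 0 <= 1) by case: (ww) => w0 _; rewrite w0 weights_le1.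
have Cu : C (u *m row' 0 V).
  apply: (IHm (row' 0 V)); last by exists u.
  move=> i; rewrite (_ : row i _ = row (lift 0 i) V) //.
  by apply/rowP => j; rewrite !mxE.
have /andP[w0 w1] := w01.
have := cC (row 0 V) (u *m row' 0 V) (@Itv01 R (w 0 0) w0 w1).
by rewrite !inE => /(_ (CV 0) Cu).
Qed.

Lemma convex_hull_rows m n (V : 'M[R]_(m, n)) :
  convex_hull (range (fun i => row i V)) = hull V.
Proof.
apply/seteqP; split.
  apply: smallest_sub => [x y t|_ [i _ <-]]; last exact: hull_row.
  rewrite !inE => -[u uw <-] [v vw <-].
  exists (t%:num *: u + (1 - t%:num) *: v); last by rewrite mulmxDl -!scalemxAl.
  apply: weights_comb => //.
  by rewrite ge0 le1.
apply: convex_set_hull.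
  move=> x y t; rewrite !inE => xV yV C [cC VC].
  by apply/set_mem/cC; rewrite inE; [exact: xV | exact: yV].
by move=> i C [_]; apply; exists i.
Qed.

(** Some row has nonzero weight in [v]. Either that weight is 1, or [weights_split] makes [v] a
    proper convex combination involving that row, and extremality forces equality. *)
Lemma vertices_hull m n (V : 'M[R]_(m, n)) v :
  vertices (hull V) v -> exists i, v = row i V.
Proof.
case: m V => [|m] V [[w ww <-] extr].
  by have [_ /eqP] := ww; rewrite big_ord0 eq_sym oner_eq0.
have [i wi0] : exists i, w 0 i != 0.
  apply: contrapT => /forallNP w0.
  have [_ /eqP] := ww; rewrite big1 ?(eq_sym 0) ?oner_eq0// => i _.
  by apply/eqP/negPn/negP/w0.
exists i; have [wi1|wi1] := eqVneq (w 0 i) 1.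
  by rewrite (weights_eq1 ww wi1) -rowE.
have [u uw wV] := weights_split V ww wi1.
have hu : hull V (u *m row' i V).
  apply: (@hull_sub _ _ _ (row' i V) V); last by exists u.
  move=> j; rewrite (_ : row j _ = row (lift i j) V); first exact: hull_row.
  by apply/rowP => k; rewrite !mxE.
have wi01 : 0 < w 0 i < 1.
  by rewrite !lt_neqAle eq_sym wi0 wi1 weights_le1//; case: ww => ->.
by have [->] := extr _ _ _ (hull_row V i) hu wi01 wV.
Qed.

(** A row outside the hull of the others is extreme. If it is a proper combination of two points of
    the hull, the combined weight at [i] is either 1, so both points equal the row, or not 1, and
    solving for the row puts it in the hull of the others. *)
Lemma hull_row' m n (V : 'M[R]_(m.+1, n)) i :
  ~ vertices (hull V) (row i V) -> hull V = hull (row' i V).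
Proof.
move=> nvert.
have sub' : hull (row' i V) `<=` hull V.
  apply: hull_sub => j; rewrite (_ : row j _ = row (lift i j) V).
    exact: hull_row.
  by apply/rowP => k; rewrite !mxE.
apply/seteqP; split=> //.
suff hi : hull (row' i V) (row i V).
  apply: hull_sub => j; case: (unliftP i j) => [k ->|->//].
  rewrite (_ : row (lift i k) V = row k (row' i V)); first exact: hull_row.
  by apply/rowP => l; rewrite !mxE.
apply: contrapT => nhi; apply: nvert; split; first exact: hull_row.
move=> _ _ t [a aw <-] [b bw <-] /andP[t0 t1] vE.
pose w := t *: a + (1 - t) *: b.
have t01 : 0 <= t <= 1 by rewrite !ltW.
have ww : weights R m.+1 w by exact: weights_comb.
have wV : w *m V = row i V by rewrite vE mulmxDl -!scalemxAl.
have [wi1|wi1] := eqVneq (w 0 i) 1.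
  have a1 := weights_le1 i aw; have b1 := weights_le1 i bw.
  move: wi1; rewrite !mxE => wi1.
  have ta : 0 <= t * (1 - a 0 i) by rewrite mulr_ge0 ?subr_ge0// ltW.
  have tb : 0 <= (1 - t) * (1 - b 0 i) by rewrite mulr_ge0 ?subr_ge0// ltW.
  have tab : t * (1 - a 0 i) + (1 - t) * (1 - b 0 i) = 0.
    rewrite -[RHS](subrr 1) -[in X in _ = _ - X]wi1 !mulrBr !mulr1; ring.
  move/eqP: tab; rewrite paddr_eq0 // !mulf_eq0 !subr_eq0 (gt_eqF t0).
  rewrite (gt_eqF t1) /= => /andP[/eqP a1' /eqP b1'].
  by rewrite (weights_eq1 aw (esym a1')) (weights_eq1 bw (esym b1')) -rowE.
exfalso; apply: nhi; have [u uw] := weights_split V ww wi1.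
rewrite wV => uE; exists u => //.
have wi1' : 1 - w 0 i != 0 by rewrite subr_eq0 eq_sym.
apply: (scalerI wi1'); rewrite [RHS]scalerBl scale1r {1}uE.
by rewrite addrAC subrr add0r.
Qed.

Lemma finite_set_rows n (A : set 'rV[R]_n) : finite_set A ->
  exists m (V : 'M[R]_(m, n)), A = range (fun i => row i V).
Proof.
move=> /finite_seqP[s ->]; exists (size s), (\matrix_(i < size s) s`_i).
apply/seteqP; split=> [x /= xs|_ [i _ <-]]; last by rewrite rowK /= mem_nth.
move: (xs); rewrite -index_mem => lt_xs.
by exists (Ordinal lt_xs) => //; rewrite rowK /= nth_index.
Qed.

(** Rows that are not extreme are deleted one at a time. This is needed because [lattice_polytope]
    constrains the extreme points, not the chosen generators. *)
Lemma polytope_hull_vertices n (P : set 'rV[R]_n) : is_polytope P ->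
  exists m (V : 'M[R]_(m, n)), P = hull V /\ forall i, vertices P (row i V).
Proof.
move=> [A /finite_set_rows[m [V ->]] ->]; rewrite convex_hull_rows.
elim: m V => [|m IHm] V; first by exists 0%N, V; split=> // -[].
have [allv|] := pselect (forall i, vertices (hull V) (row i V)).
  by exists m.+1, V.
by move=> /existsNP[i /hull_row' ->]; exact: IHm.
Qed.

End Hull.

(** * Covering radii of polytopes *)

Section Covering.
Variable R : realType.
Implicit Types m n k : nat.

Lemma interior_cubeP n (A : set 'rV[R]_n) p :
  A° p <-> exists2 e : R, 0 < e &
    forall x : 'rV[R]_n, (forall i, `|x 0 i - p 0 i| <= e) -> A x.
Proof.
split=> [/nbhs_ballP[e /= e0 eA]|[e e0 eA]].
  have e2 : 0 < e / 2 by rewrite divr_gt0.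
  exists (e / 2) => // x xe; apply: eA; split=> // i j.
  rewrite (ord1 i) -ball_normE /ball_ /= distrC (le_lt_trans (xe j)) //.
  by rewrite ltr_pdivrMr // mulr_natr mulr2n ltrDl.
apply/nbhs_ballP; exists e => //= x [_ xe]; apply: eA => i.
by have := xe 0 i; rewrite -ball_normE /ball_ /= distrC => /ltW.
Qed.

Lemma covers_mulmx n (K L : set 'rV[R]_n) (B : 'M[R]_n) mu :
  B \in unitmx -> covers K L mu ->
  covers [set x *m B | x in K] [set x *m B | x in L] mu.
Proof.
move=> uB KL; apply/seteqP; split=> // x _.
have [p Kp [z Lz pz]] : [set mu *: p + z | p in K & z in L] (x *m invmx B).
  by rewrite KL.
exists (p *m B); first by exists p.
exists (z *m B); first by exists z.
by rewrite scalemxAl -mulmxDl pz mulmxKV.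
Qed.

(** The translation [mu *: p] of the dilate is absorbed into the point to be covered. *)
Lemma covers_shift n (K K' L L' : set 'rV[R]_n) (p : 'rV[R]_n) mu :
  (forall x, K x -> K' (x + p)) -> L `<=` L' ->
  covers K L mu -> covers K' L' mu.
Proof.
move=> KK' LL' KL; apply/seteqP; split=> // x _.
have [q Kq [z Lz qz]] : [set mu *: p + z | p in K & z in L] (x - mu *: p).
  by rewrite KL.
exists (q + p); first exact: KK'.
exists z; first exact: LL'.
by rewrite scalerDr addrAC qz subrK.
Qed.

(** Since 0 is itself a convex combination of the rows, unspent weight can be put on that
    combination without moving the point. Hence an inequality on the total weight suffices. *)
Lemma covers_hullP m n (V : 'M[R]_(m, n)) (L : set 'rV[R]_n) mu :
  hull V 0 -> 0 <= mu ->
  covers (hull V) L mu <-> forall x, exists w : 'rV[R]_m,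
    [/\ forall i, 0 <= w 0 i, \sum_i w 0 i <= mu & L (x - w *m V)].
Proof.
move=> V0 mu0; split=> [cov x|cov].
  have [_ [w [w0 w1] <-] [z Lz wz]] :
    [set mu *: p + z | p in hull V & z in L] x by rewrite cov.
  exists (mu *: w); split=> [i||].
  - by rewrite mxE mulr_ge0.
  - under eq_bigr do rewrite mxE.
    by rewrite -mulr_sumr w1 mulr1.
  - by rewrite -scalemxAl -wz addrAC subrr add0r.
apply/seteqP; split=> // x _.
have [w0 [w00 w01] w0V] := V0.
have [w [wge0 wle Lw]] := cov x.
pose s := \sum_i w 0 i; pose v := w + (mu - s) *: w0.
have vV : v *m V = w *m V by rewrite mulmxDl -scalemxAl w0V scaler0 addr0.
have v0 i : 0 <= v 0 i by rewrite !mxE addr_ge0 // mulr_ge0 // subr_ge0.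
have sv : \sum_i v 0 i = mu.
  under eq_bigr do rewrite !mxE.
  by rewrite big_split /= -mulr_sumr w01 mulr1 addrC subrK.
(* Normalizing [v] divides by [mu]; for [mu = 0] all the weights vanish instead. *)
have [mu_eq0|mu_neq0] := eqVneq mu 0.
  exists 0; first by [].
  exists (x - w *m V) => //.
  rewrite -vV (_ : v = 0) ?mul0mx ?scaler0 ?add0r ?subr0//.
  apply/rowP => i; rewrite [RHS]mxE.
  by apply: (psumr_eq0P _ (etrans sv mu_eq0)).
exists (mu^-1 *: v *m V).
  exists (mu^-1 *: v) => //; split=> [i|].
    by rewrite mxE mulr_ge0 // invr_ge0.
  under eq_bigr do rewrite mxE.
  by rewrite -mulr_sumr sv mulVf.
exists (x - w *m V) => //.
by rewrite -scalemxAl scalerA divff // scale1r vV addrC subrK.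
Qed.

(** * Attainment of the covering radius *)

Lemma closed_int : closed [set x : R | x \is a Num.int].
Proof.
rewrite (_ : [set _ | _] =
    ~` \bigcup_(k : int) `]k%:~R, (k + 1)%:~R[%classic :> set R).
  by apply: open_closedC; apply: bigcup_open => k _; exact: interval_open.
apply/seteqP; split=> x /=.
  move=> /intrP[z ->] [k _] /=; rewrite in_itv /= !ltr_int ltzD1.
  by case: ltgtP.
move=> nx; apply: contrapT => xi; apply: nx; exists (Num.floor x) => //=.
rewrite in_itv /= floorD1_gt andbT lt_neqAle floor_le andbT.
by apply/negP => /eqP xE; apply: xi; rewrite -xE intr_int.
Qed.

Lemma continuous_mulmx_coord m n (V : 'M[R]_(m, n)) j :
  continuous (fun w : 'rV[R]_m => (w *m V) 0 j).
Proof.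
rewrite (_ : (fun w => _) = (fun w : 'rV[R]_m => \sum_i w 0 i * V i j)).
  apply: continuous_big; first exact: add_continuous.
  by move=> i _ w; apply: (@cvgMl R _ (nbhs w)); exact: (@coord_continuous R 1 m 0 i).
by apply/funext => w; rewrite mxE.
Qed.

Lemma covering_radius_exists m n (V : 'M[R]_(m, n)) :
  (hull V)° 0 -> exists mu, is_covering_radius (hull V) (int_lattice R n) mu.
Proof.
move=> Vint; have V0 : hull V 0 by exact: interior_subset Vint.
set L := int_lattice R n.
pose E := [set mu | 0 <= mu /\ covers (hull V) L mu].
have E0 : lbound E 0 by move=> mu [].
have [mu1 Emu1] : E !=set0.
  (* The hull contains a cube of radius [e], so its dilate by [e^-1] contains the fractional part of
     every point. *)
  have [e e0 eV] := (interior_cubeP _ _).1 Vint.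
  exists e^-1; split; first by rewrite invr_ge0 ltW.
  apply/seteqP; split=> // x _.
  pose z : 'rV[R]_n := \row_i (Num.floor (x 0 i))%:~R.
  exists (e *: (x - z)).
    apply: eV => i; rewrite !mxE subr0 normrM (gtr0_norm e0).
    rewrite ger_pMr // ger0_norm ?subr_ge0 ?floor_le //.
    by rewrite lerBlDl -intrD1 ltW ?floorD1_gt.
  exists z; first by move=> i; rewrite mxE intr_int.
  by rewrite scalerA mulVf ?gt_eqF // scale1r subrK.
have hE : has_inf E by split; [exists mu1 | exists 0].
have mu0_ge0 : 0 <= inf E by apply: lb_le_inf => //; exists mu1.
exists (inf E); split; last by move=> mu Emu; apply: ge_inf => //; exists 0.
split=> //; apply/covers_hullP => // x.
have coverE mu : E mu -> exists w : 'rV[R]_m,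
    [/\ forall i, 0 <= w 0 i, \sum_i w 0 i <= mu & L (x - w *m V)].
  by move=> [mu_ge0 /covers_hullP]; exact.
(* The least total weight needed to reach x modulo L is attained, because the
   admissible weights form a compact set. *)
pose C := [set w : 'rV[R]_m | forall i, `[0, mu1]%classic (w 0 i)] `&`
  \bigcap_(j : 'I_n) [set w : 'rV[R]_m | (x - w *m V) 0 j \is a Num.int].
have CE (w : 'rV[R]_m) : (forall i, 0 <= w 0 i) -> \sum_i w 0 i <= mu1 ->
    L (x - w *m V) -> C w.
  move=> w0 wmu Lw; split=> [i|j _]; last exact: Lw.
  rewrite /= in_itv /= w0 (le_trans _ wmu) //.
  by rewrite (bigD1 i) //= lerDl sumr_ge0.
have C0 : C !=set0.
  by have [w [w0 w1 Lw]] := coverE _ Emu1; exists w; exact: CE.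
have cC : compact C.
  apply: compact_closedI.
    apply: (@rV_compact R m (fun=> `[0, mu1]%classic)) => _.
    exact: segment_compact.
  apply: closed_bigI => j _.
  rewrite (_ : [set _ | _] =
      (fun w : 'rV[R]_m => x 0 j - (w *m V) 0 j) @^-1` [set y | y \is a Num.int]).
    apply: preimage_closed closed_int => w _.
    apply: (@cvgB R R^o _ (nbhs w)); first exact: cvg_cst.
    exact: continuous_mulmx_coord.
  by apply/seteqP; split=> w /=; rewrite !mxE.
have contS : {within C, continuous (fun w : 'rV[R]_m => \sum_i w 0 i)}.
  apply: continuous_subspaceT; apply: continuous_big.
    exact: add_continuous.
  by move=> i _ w; exact: (@coord_continuous R 1 m 0 i).
have [w Cw wmin] := EVT_min_rV C0 cC contS.
move: Cw; rewrite inE => -[w0 Lw]; exists w; split=> [i||j].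
- by have := w0 i; rewrite /= in_itv => /andP[].
- apply: lb_le_inf; first by exists mu1.
  (* The minimum over [C] is compared with each admissible [mu]. Only [mu <= mu1] gives weights
     inside the box [C]; larger values follow from [mu1]. *)
  have min_le mu : E mu -> mu <= mu1 -> \sum_i w 0 i <= mu.
    move=> /coverE[v [v0 v1 Lv]] mu_le; apply: le_trans (v1).
    by apply: wmin; rewrite inE; apply: CE => //; exact: le_trans mu_le.
  move=> mu Emu; have [/min_le|/ltW] := leP mu mu1; first exact.
  by apply: le_trans; exact: min_le.
- exact: Lw.
Qed.

End Covering.

(** * The simplex S(1_{n+1}) *)

(* Row 0 is -1_n and row i + 1 is e_i. *)
Definition S1_mx (R : realType) (n : nat) : 'M[R]_(n.+1, n) :=
  \matrix_(k < n.+1, j < n) ((k == lift ord0 j)%:R - (k == ord0)%:R).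

Section Simplex.
Variable R : realType.
Implicit Types m n l : nat.

Lemma mulmx_S1_mx n (w : 'rV[R]_n.+1) j :
  (w *m S1_mx R n) 0 j = w 0 (lift ord0 j) - w 0 ord0.
Proof.
rewrite mxE; under eq_bigr do rewrite mxE mulrBr.
rewrite big_split /= sumrN; congr (_ - _).
  rewrite (bigD1 (lift ord0 j)) //= eqxx mulr1 big1 ?addr0 // => k kj.
  by rewrite (negbTE kj) mulr0.
rewrite (bigD1 ord0) //= mulr1 big1 ?addr0 // => k kj.
by rewrite (negbTE kj) mulr0.
Qed.

Lemma S1_hull n : S1 R n = hull (S1_mx R n).
Proof.
rewrite -convex_hull_rows /S1; congr convex_hull.
have row0 : row ord0 (S1_mx R n) = const_mx (-1).
  by apply/rowP => j; rewrite !mxE /= sub0r.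
have rowS i : row (lift ord0 i) (S1_mx R n) = delta_mx 0 i.
  by apply/rowP => j; rewrite !mxE /= (inj_eq lift_inj) subr0 eq_sym.
apply/seteqP; split=> [x [->|[i _ <-]]|_ [k _ <-]].
- by exists ord0.
- by exists (lift ord0 i).
- case: (unliftP ord0 k) => [i ->|->]; last by left.
  by right; exists i.
Qed.

(** The vertices sum to 0, so a common weight [t] on all of them does not move a point; putting
    [t + x 0 i] on each e_i and [t] on -1_n represents [x]. *)
Lemma S1_interior0 n : (hull (S1_mx R n))° 0.
Proof.
(* With this radius e, the coordinate sum is at most n e, and 1 - n e = (n + 1) e, so [t] is at
   least e and outweighs any negative coordinate. *)
apply/interior_cubeP; exists (2 * n%:R + 1)^-1.
  by rewrite invr_gt0 ltr_wpDl ?mulr_ge0.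
move=> x xe; set e := _^-1 in xe.
have eE : e * (2 * n%:R + 1) = 1.
  by rewrite mulVf // gt_eqF // ltr_wpDl ?mulr_ge0.
have {}xe i : `|x 0 i| <= e by have := xe i; rewrite mxE subr0.
have n1 : 0 < n.+1%:R :> R by [].
pose s := \sum_i x 0 i; pose t : R := (1 - s) / n.+1%:R.
have tE : t * n.+1%:R = 1 - s by rewrite divfK ?gt_eqF.
have s_le : s <= n%:R * e.
  apply: (@le_trans _ _ (\sum_(i < n) e)).
    by apply: ler_sum => i _; exact: le_trans (ler_norm _) (xe i).
  by rewrite sumr_const card_ord mulr_natl.
have et : e <= t.
  rewrite ler_pdivlMr // -natr1; move: s_le eE; move: (n%:R) => a; lra.
have e0 : 0 <= e by rewrite invr_ge0 addr_ge0 ?mulr_ge0.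
exists (\row_k t + \row_k (if unlift ord0 k is Some i then x 0 i else 0)).
  split=> [k|].
    rewrite !mxE; case: unliftP => [i _|_]; last by rewrite addr0 (le_trans e0).
    have := xe i; rewrite ler_norml => /andP[]; lra.
  under eq_bigr do rewrite !mxE.
  rewrite big_split /= sumr_const card_ord -mulr_natr tE big_ord_recl.
  rewrite unlift_none add0r; under eq_bigr do rewrite liftK.
  by rewrite subrK.
by apply/rowP => j; rewrite mulmx_S1_mx !mxE liftK unlift_none addr0 addrAC subrr add0r.
Qed.

(** A section [G] of [F] lifts a small cube around 0 into the given one; [C] bounds the distortion
    of [G], and [C + 1] avoids dividing by 0. *)
Lemma hull_mulmx_interior0 (m n k : nat) (V : 'M[R]_(m, n)) (F : 'M[R]_(n, k)) :
  row_full F -> (hull V)° 0 -> (hull (V *m F))° 0.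
Proof.
move=> /row_fullP[G GF] /interior_cubeP[e e0 eV].
pose C := \sum_i \sum_j `|G i j|.
have C0 : 0 <= C by apply: sumr_ge0 => i _; apply: sumr_ge0.
apply/interior_cubeP; exists (e / (C + 1)); first by rewrite divr_gt0 ?ltr_wpDl.
move=> y ye; rewrite -hull_mulmx; exists (y *m G).
  apply: eV => j; rewrite !mxE subr0 (le_trans (ler_norm_sum _ _ _)) //.
  apply: (@le_trans _ _ (e / (C + 1) * C)).
    rewrite mulr_sumr; apply: ler_sum => i _; rewrite normrM.
    apply: ler_pM => //; first by have := ye i; rewrite mxE subr0.
    by rewrite (bigD1 j) //= lerDl sumr_ge0.
  by rewrite mulrAC ler_pdivrMr ?ltr_wpDl // ler_pM2l // lerDl.
by rewrite -mulmxA GF mulmx1.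
Qed.

(** * Lower bound for the coordinate projection *)

Lemma sum_ord_natr N : \sum_(k < N) k%:R = N%:R * (N%:R - 1) / 2 :> R.
Proof.
elim: N => [|N IHN]; first by rewrite big_ord0 !mul0r.
by rewrite big_ord_recr /= IHN -natr1; field.
Qed.

Lemma S1_proj_covers_ge l n mu : (l <= n)%N -> 0 <= mu ->
  covers (hull (S1_mx R n *m (pid_mx l : 'M[R]_(n, l)))) (int_lattice R l) mu ->
  l%:R / 2 <= mu.
Proof.
move=> ln mu0 cov; pose N := l.+1.
have N0 : 0 < N%:R :> R by [].
pose x : 'rV[R]_l := \row_j (j.+1%:R / N%:R).
have [_ [w [w0 w1] <-] [z zint wz]] :
  [set mu *: p + z | p in hull (S1_mx R n *m (pid_mx l : 'M[R]_(n, l))) &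
     z in int_lattice R l] x by rewrite cov.
have lN : (N <= n.+1)%N by [].
pose y (k : 'I_N) := mu * w 0 (widen_ord lN k).
(* [y] keeps the scaled weights of -1_n, e_1, ..., e_l only; the remaining vertices project to 0, so
   dropping their weights only lowers the total. *)
have y0 k : 0 <= y k by rewrite mulr_ge0.
have ymu : \sum_k y k <= mu.
  rewrite -mulr_sumr -(big_ord_narrow (F := fun k => w 0 k) lN).
  apply: ler_piMr => //; rewrite -w1 [leRHS](bigID (fun k : 'I_n.+1 => k < N)%N) /=.
  by rewrite lerDl sumr_ge0.
have yE (k : 'I_N) : exists q : int,
    N%:R * y k = N%:R * y ord0 + k%:R - N%:R * q%:~R.
  case: (unliftP ord0 k) => [j ->|->]; last first.
    by exists 0; rewrite mulr0 subr0 addr0.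
  have /intrP[q zq] := zint j; exists q.
  have := congr1 (fun v : 'rV[R]_l => v 0 j) wz; rewrite mxE [in RHS]mxE zq mxE.
  have -> : (w *m (S1_mx R n *m (pid_mx l : 'M[R]_(n, l)))) 0 j =
            (w *m S1_mx R n) 0 (widen_ord ln j).
    have pidE i : (pid_mx l : 'M[R]_(n, l)) i j = (i == widen_ord ln j)%:R.
      rewrite mxE -val_eqE /=; case: eqP => // ->.
      by rewrite ltn_ord.
    rewrite mulmxA mxE (bigD1 (widen_ord ln j)) //= pidE eqxx mulr1.
    by rewrite big1 ?addr0 // => i ij; rewrite pidE (negbTE ij) mulr0.
  rewrite mulmx_S1_mx => /(congr1 ( *%R N%:R)).
  rewrite [in RHS](mulrC N%:R) divfK ?gt_eqF // => <-.
  rewrite /y (_ : widen_ord lN ord0 = ord0); last exact/val_inj.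
  rewrite (_ : widen_ord lN (lift ord0 j) = lift ord0 (widen_ord ln j)).
    ring.
  exact/val_inj.
have [a aE] : exists a : nat, (Num.floor (N%:R * y ord0)) = a%:Z.
  by exists `|Num.floor (N%:R * y ord0)|%N; rewrite gez0_abs ?floor_ge0 ?mulr_ge0.
have floorP := floor_itv (N%:R * y ord0).
(* N y_k is congruent to N y_0 + k modulo N and nonnegative, hence at least the
   residue of floor (N y_0) + k; these residues exhaust 0, ..., N - 1. *)
have ry (k : 'I_N) : ((a + k) %% N)%N%:R <= N%:R * y k.
  have [q yq] := yE k.
  (* [N%:R * y k] equals [N%:R * p%:~R] plus the residue plus the fractional part of
     [N%:R * y ord0]. A negative [p] would make it negative, since the residue is at most N - 1. *)
  pose p : int := ((a + k) %/ N)%N%:Z - q.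
  have ak : a%:R + k%:R = ((a + k) %/ N)%N%:R * N%:R + ((a + k) %% N)%N%:R :> R.
    by rewrite -!natrD -natrM -natrD -divn_eq.
  have rN : ((a + k) %% N)%N%:R + 1 <= N%:R :> R.
    by rewrite natr1 ler_nat ltn_mod.
  have Ny0 : 0 <= N%:R * y k by rewrite mulr_ge0.
  have pE : p%:~R = ((a + k) %/ N)%N%:R - q%:~R :> R by rewrite rmorphB.
  move: floorP; rewrite aE intrD -pmulrn => /andP[fl1 fl2].
  have : 0 <= p.
    rewrite leNgt; apply/negP => p0.
    have p1 : p%:~R <= -1 :> R by rewrite (_ : -1 = (-1)%:~R) // ler_int; lia.
    have : N%:R * p%:~R <= - N%:R :> R by rewrite -mulrN1 ler_pM2l.
    by rewrite pE; lra.
  rewrite -(ler0z R) => p0.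
  have : 0 <= N%:R * p%:~R :> R by rewrite mulr_ge0.
  by rewrite pE; lra.
pose h (k : 'I_N) : 'I_N := Ordinal (ltn_pmod (a + k) (ltn0Sn l)).
have h_inj : injective h.
  move=> i j /(congr1 val) /= /eqP; rewrite eqn_modDl !modn_small //.
  by move=> /eqP/val_inj.
have : \sum_(k < N) k%:R <= N%:R * mu.
  apply: (@le_trans _ _ (\sum_k N%:R * y k)); last by rewrite -mulr_sumr ler_pM2l.
  by rewrite (reindex_inj h_inj) /=; apply: ler_sum => k _; exact: ry.
by rewrite sum_ord_natr -mulrA ler_pM2l // /N -natr1 addrK.
Qed.

End Simplex.

(** * Integer matrices and lattices *)

Section Lattice.
Variable R : realType.
Implicit Types m n l : nat.

Lemma mxOver_int_map m n (A : 'M[R]_(m, n)) :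
  A \is a mxOver Num.int -> exists A' : 'M[int]_(m, n), A = map_mx intr A'.
Proof.
move=> /mxOverP Aint; exists (map_mx Num.floor A).
by apply/matrixP => i j; rewrite !mxE floorK.
Qed.

Lemma map_intr_mxOver m n (A : 'M[int]_(m, n)) :
  map_mx intr A \is a @mxOver m n R Num.int.
Proof. by apply/mxOverP => i j; rewrite mxE intr_int. Qed.

Lemma int_latticeP n (x : 'rV[R]_n) :
  int_lattice R n x <-> x \is a mxOver Num.int.
Proof.
split=> [xint|/mxOverP xint i]; last exact: xint.
by apply/mxOverP => i j; rewrite (ord1 i); exact: xint.
Qed.

Lemma int_lattice_mulmx n l (F : 'M[R]_(n, l)) x :
  F \is a mxOver Num.int -> int_lattice R n x -> int_lattice R l (x *m F).
Proof. by move=> Fint /int_latticeP xint; apply/int_latticeP/mxOverM. Qed.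

(** In the Smith normal form of the integer matrix, the unimodular left factor does not change the
    integer row span. What remains is a square matrix [B], whose rows form a basis because the image
    has full rank. *)
Lemma is_lattice_image n l (F : 'M[R]_(n, l)) :
  F \is a mxOver Num.int -> row_full F ->
  is_lattice [set x *m F | x in int_lattice R n].
Proof.
move=> /mxOver_int_map[M ->] fullF.
have ln : (l <= n)%N by rewrite -(eqP fullF) rank_leq_row.
have [L uL [Q uQ [d _ ME]]] := int_Smith_normal_form M.
pose B := diag_mx (\row_(j < l) d`_j) *m Q.
have {}ME : M = L *m pid_mx l *m B.
  rewrite ME /B mulmxA; congr (_ *m _); rewrite -mulmxA; congr (_ *m _).
  rewrite mul_mx_diag; apply/matrixP => i j; rewrite !mxE.
  case: eqP => [->|_]; last by rewrite mul0r mulr0n.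
  by rewrite ltn_ord mul1r mulr1n.
exists (map_mx intr B).
  rewrite -row_full_unit -sub1mx (submx_trans _ (_ : map_mx intr M <= _)%MS) //.
    by rewrite sub1mx.
  by rewrite ME map_mxM submxMl.
apply/seteqP; split=> _ [x /int_latticeP/mxOver_int_map[z ->] <-].
  exists (map_mx intr (z *m L *m pid_mx l)).
    exact/int_latticeP/map_intr_mxOver.
  by rewrite ME -!map_mxM !mulmxA.
(* This preimage is integral because [L] is invertible over the integers. *)
exists (map_mx intr (z *m pid_mx l *m invmx L)).
  exact/int_latticeP/map_intr_mxOver.
rewrite ME -!map_mxM; congr map_mx; rewrite !mulmxA mulmxKV //.
rewrite -(mulmxA z) (_ : _ *m pid_mx l = 1%:M) ?mulmx1 //.
by rewrite pid_mx_id // pid_mx_1.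
Qed.

Lemma covering_radius_mulmx n (K L : set 'rV[R]_n) (B : 'M[R]_n) mu :
  B \in unitmx -> is_covering_radius K L mu ->
  is_covering_radius [set x *m B | x in K] [set x *m B | x in L] mu.
Proof.
move=> uB [[mu0 cov] lb]; split; first by split=> //; exact: covers_mulmx.
move=> nu [nu0 /(covers_mulmx (B := invmx B))]; rewrite unitmx_inv => /(_ uB).
have canc (A : set 'rV[R]_n) : [set x *m invmx B | x in [set x *m B | x in A]] = A.
  rewrite image_comp -[RHS]image_id; apply: eq_imagel => x _ /=.
  by rewrite mulmxK.
by rewrite !canc => nucov; apply: lb.
Qed.

(** The inverse of a lattice basis reduces this to the integer lattice. *)
Lemma lattice_covering_radius_exists m n (V : 'M[R]_(m, n)) L :
  (hull V)° 0 -> is_lattice L -> exists mu, is_covering_radius (hull V) L mu.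
Proof.
move=> Vint [B uB ->].
have [|mu] := @covering_radius_exists R m n (V *m invmx B).
  apply: hull_mulmx_interior0 => //.
  by rewrite row_full_unit unitmx_inv.
move=> /(covering_radius_mulmx uB); rewrite hull_mulmx mulmxKV //.
by exists mu.
Qed.

(** * Positive integer relations among lattice points *)

Lemma clear_denominators m (q : 'I_m -> rat) : (forall i, 0 < q i) ->
  exists (D : nat) (a : 'I_m -> nat), (0 < D)%N /\
    forall i, (0 < a i)%N /\ (a i)%:R = D%:R * q i.
Proof.
move=> q0; pose D := (\prod_i `|denq (q i)|)%N.
have D0 : (0 < D)%N by apply: prodn_gt0 => i; rewrite absz_gt0 denq_neq0.
exists D.
suff /choice[a aP] i : exists a : nat, (0 < a)%N /\ a%:R = D%:R * q i.
  by exists a.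
exists (`|numq (q i)| * \prod_(j | j != i) `|denq (q j)|)%N.
rewrite muln_gt0 absz_gt0 numq_eq0 gt_eqF //=; split.
  by apply: prodn_gt0 => j; rewrite absz_gt0 denq_neq0.
rewrite /D [in RHS](bigD1 i) //= !natrM [RHS]mulrAC; congr (_ * _).
rewrite -[X in _ = _ * X](divq_num_den (q i)) !natr_absz.
rewrite gtr0_norm ?numq_gt0 // (gtr0_norm (denq_gt0 _)).
by rewrite [RHS]mulrC divfK // intr_eq0 denq_neq0.
Qed.

(** A real relation is approximated by a rational one, whose denominators are then cleared. The
    uniform lower bound [e] leaves room to keep all coefficients positive. *)
Lemma positive_int_relation m l (M : 'M[R]_(m, l)) (u : 'rV[R]_m) (e : R) :
  M \is a mxOver Num.int -> 0 < e -> (forall i, e <= u 0 i) -> u *m M = 0 ->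
  exists a : 'I_m -> nat, (forall i, (0 < a i)%N) /\
    \sum_i (a i)%:R *: row i M = 0.
Proof.
move=> /mxOver_int_map[A ->] e0 ue uA.
pose Aq : 'M[rat]_(m, l) := map_mx intr A.
have AE : map_mx intr A = map_mx ratr Aq :> 'M[R]_(m, l).
  by apply/matrixP => i j; rewrite !mxE ratr_int.
have [K [KA uK]] : exists K : 'M[rat]_m,
    K *m Aq = 0 /\ (u <= map_mx (@ratr R) K)%MS.
  exists (kermx Aq); split; first exact: mulmx_ker.
  by rewrite map_kermx -AE; apply/sub_kermxP.
pose KR : 'M[R]_m := map_mx ratr K.
have /submxP[c uE] := uK.
pose C := \sum_i \sum_j `|KR i j|.
have C0 : 0 <= C by apply: sumr_ge0 => i _; apply: sumr_ge0.
have C10 : 0 < C + 1 by rewrite ltr_wpDl.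
(* The rational kernel K also spans the real one, so a rational approximation
   of the coordinates of u in K is still an exact relation. *)
have /choice[r rP] i : exists r : rat, `|c 0 i - ratr r| <= e / 2 / (C + 1).
  have lt : c 0 i < c 0 i + e / 2 / (C + 1) by rewrite ltrDl !divr_gt0.
  have [r] := rat_in_itvoo lt; rewrite in_itv /= => /andP[r1 r2].
  by exists r; rewrite distrC ger0_norm ?subr_ge0 ?(ltW r1) // lerBlDl ltW.
pose q := (\row_i r i) *m K.
have q0 i : 0 < q 0 i.
  rewrite -(ltr0q R).
  (* [C] bounds the absolute entries of the kernel matrix, so the errors in [c] move each
     coefficient by at most [e / 2]. *)
  have : `|u 0 i - ratr (q 0 i)| <= e / 2.
    rewrite uE !mxE rmorph_sum -sumrB (le_trans (ler_norm_sum _ _ _)) //.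
    apply: (@le_trans _ _ (e / 2 / (C + 1) * C)).
      rewrite mulr_sumr; apply: ler_sum => j _.
      rewrite !mxE rmorphM -mulrBl normrM; apply: ler_pM => //.
      by rewrite (bigD1 i) //= mxE lerDl sumr_ge0.
    by rewrite mulrAC ler_pdivrMr // ler_pM2l ?divr_gt0 // lerDl.
  rewrite ler_norml => /andP[_]; have := ue i; lra.
have qA : q *m Aq = 0 by rewrite /q -mulmxA KA mulmx0.
have [D [a [D0 aP]]] := clear_denominators q0.
exists a; split=> [i|]; first by case: (aP i).
apply/rowP => j; rewrite summxE mxE.
have := congr1 (fun v : 'rV[rat]_l => D%:R * v 0 j) qA.
rewrite !mxE mulr0 mulr_sumr => /(congr1 (@ratr R)).
rewrite rmorph_sum rmorph0 => s0; rewrite -[RHS]s0; apply: eq_bigr => i _.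
have [_ aE] := aP i.
by rewrite mulrA -aE rmorphM rmorph_nat !mxE /= ratr_int.
Qed.

End Lattice.

(** * The equivalence *)

Section Equivalence.
Variable R : realType.
Implicit Types m n l : nat.

(** Row [i] is taken [a i * d.+1] times: the extra factor preserves the zero sum and makes the
    number of copies exceed [d]. The map [g] enumerates the pairs of a row index and a copy
    number. *)
Lemma repeat_rows m l (V : 'M[R]_(m, l)) (a : 'I_m -> nat) (d : nat) :
  (0 < m)%N -> (forall i, (0 < a i)%N) -> \sum_i (a i)%:R *: row i V = 0 ->
  exists n (g : 'I_n.+1 -> 'I_m),
    [/\ (d <= n)%N, forall i, exists k, g k = i & \sum_k row (g k) V = 0].
Proof.
move=> m0 a0 aV; pose T : finType := {i : 'I_m & 'I_(a i * d.+1)}.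
have cardT : #|T| = (\sum_i a i * d.+1)%N.
  rewrite card_tagged sumnE big_map big_enum.
  by apply: eq_bigr => i _; rewrite card_ord.
have dT : (d < #|T|)%N.
  rewrite cardT (bigD1 (Ordinal m0)) //= (leq_trans _ (leq_addr _ _)) //.
  by rewrite leq_pmull.
have Tn : #|T|.-1.+1 = #|T| by rewrite prednK // (leq_ltn_trans _ dT).
exists #|T|.-1, (fun k => tag (enum_val (cast_ord Tn k))); split=> [|i|].
- by rewrite -ltnS Tn.
- have ai : (0 < a i * d.+1)%N by rewrite muln_gt0 a0.
  pose t : T := Tagged (fun i => 'I_(a i * d.+1)) (Ordinal ai).
  by exists (cast_ord (esym Tn) (enum_rank t)); rewrite cast_ordKV enum_rankK.
rewrite -(@reindex _ _ _ _ _ (fun k => enum_val (cast_ord Tn k)) xpredT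
  (fun t : T => row (tag t) V)) /=; last first.
  exists (fun t => cast_ord (esym Tn) (enum_rank t)) => [k|t] _.
    by rewrite enum_valK cast_ordK.
  by rewrite cast_ordKV enum_rankK.
rewrite -(@sig_big_dep _ _ _ _ _ xpredT (fun _ => xpredT) (fun i _ => row i V)) /=.
under eq_bigr => i _ do rewrite sumr_const card_ord mulrnA -(scaler_nat (a i)).
by rewrite sumrMnl aV mul0rn.
Qed.

(** The map sends e_1, ..., e_n to the rows of [W] after the first, hence -1_n to minus their sum,
    which is the first row. *)
Lemma S1_mx_row' n l (W : 'M[R]_(n.+1, l)) : \sum_k row k W = 0 ->
  S1_mx R n *m row' ord0 W = W.
Proof.
move=> W0; apply/row_matrixP => k; apply/rowP => j; rewrite !mxE.
under eq_bigr do rewrite !mxE mulrBl.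
rewrite sumrB -mulr_sumr; case: (unliftP ord0 k) => [i ->|->].
  rewrite /= mul0r subr0 (bigD1 i) //= eqxx mul1r big1 ?addr0 // => i' i'i.
  by rewrite (inj_eq lift_inj) eq_sym (negbTE i'i) mul0r.
rewrite eqxx mul1r big1 ?sub0r; last by move=> i _; rewrite mul0r.
have := congr1 (fun v : 'rV[R]_l => v 0 j) W0.
rewrite summxE big_ord_recl !mxE => /eqP; rewrite addr_eq0 => /eqP ->.
by congr (- _); apply: eq_bigr => i _; rewrite mxE.
Qed.

(** Small multiples of the unit vectors lie in the hull, hence in the row space. *)
Lemma hull_interior_row_full m n (V : 'M[R]_(m, n)) :
  (hull V)° 0 -> row_full V.
Proof.
move=> /interior_cubeP[e e0 eV]; rewrite -sub1mx; apply/row_subP => i.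
rewrite rowE mulmx1; have [|w _ wV] := eV (e *: delta_mx 0 i).
  move=> j; rewrite !mxE subr0 eqxx /=; case: eqP => _.
    by rewrite mulr1 gtr0_norm.
  by rewrite mulr0 normr0 ltW.
by rewrite -(eqmx_scale _ (lt0r_neq0 e0)) -wV submxMl.
Qed.

Lemma image_mulmx n l (f : {linear 'rV[R]_n -> 'rV[R]_l}) (A : set 'rV[R]_n) :
  f @` A = [set x *m lin1_mx f | x in A].
Proof. by apply: eq_imagel => x _; rewrite mul_rV_lin1. Qed.

Lemma row_full_surjective n l (F : 'M[R]_(n, l)) :
  row_full F <-> range (fun x : 'rV[R]_n => x *m F) = setT.
Proof.
split=> [/row_fullP[G GF]|rF].
  by apply/seteqP; split=> // y _; exists (y *m G) => //; rewrite -mulmxA GF mulmx1.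
rewrite -sub1mx; apply/row_subP => i.
have [x _ <-] : range (fun x : 'rV[R]_n => x *m F) (row i 1%:M) by rewrite rF.
exact: submxMl.
Qed.

Lemma S1_mx_int n : S1_mx R n \is a mxOver Num.int.
Proof. by apply/mxOverP => i j; rewrite mxE rpredB ?rpred_nat. Qed.

Lemma hull_lattice_polytope m n (V : 'M[R]_(m, n)) :
  V \is a mxOver Num.int -> lattice_polytope (hull V).
Proof.
move=> /mxOverP Vint; split.
  exists (range (fun i => row i V)); last by rewrite convex_hull_rows.
  exact: finite_image.
by move=> v /vertices_hull[i ->] j; rewrite mxE.
Qed.

Lemma S1_image_covering_radius n l (F : 'M[R]_(n, l)) :
  (forall P : set 'rV[R]_l, lattice_polytope P -> non_hollow P ->
     exists2 mu : R, is_covering_radius P (int_lattice R l) mu & mu <= l%:R / 2) ->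
  F \is a mxOver Num.int -> row_full F ->
  exists2 mu : R, is_covering_radius (hull (S1_mx R n *m F)) (int_lattice R l) mu &
    mu <= l%:R / 2.
Proof.
move=> bound Fint fullF; apply: bound.
  by apply: hull_lattice_polytope; apply: mxOverM => //; exact: S1_mx_int.
exists 0; split; last by move=> i; rewrite mxE rpred0.
by apply: hull_mulmx_interior0 => //; exact: S1_interior0.
Qed.

Lemma polytope_bound_covering_minimum l n :
  (forall P : set 'rV[R]_l, lattice_polytope P -> non_hollow P ->
     exists2 mu : R, is_covering_radius P (int_lattice R l) mu & mu <= l%:R / 2) ->
  (l <= n)%N -> is_covering_minimum l (S1 R n) (int_lattice R n) (l%:R / 2).
Proof.
move=> bound ln; rewrite S1_hull; split.
  pose F : 'M[R]_(n, l) := pid_mx l.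
  have fullF : row_full F by rewrite /row_full rank_pid_mx.
  have Fint : F \is a mxOver Num.int.
    by apply/mxOverP => i j; rewrite mxE rpred_nat.
  have imL : [set x *m F | x in int_lattice R n] = int_lattice R l.
    apply/seteqP; split=> [_ [x xint <-]|y yint]; first exact: int_lattice_mulmx.
    exists (y *m pid_mx l).
      apply: int_lattice_mulmx yint.
      by apply/mxOverP => i j; rewrite mxE rpred_nat.
    by rewrite -mulmxA pid_mx_id // pid_mx_1 mulmx1.
  (* The assumed upper bound and [S1_proj_covers_ge] pinch [mu] to l/2, so this projection attains
     the maximum. *)
  have [mu [[mu0 cov] lb] mu_le] := S1_image_covering_radius bound Fint fullF.
  exists (mulmxr F); split=> /=.
  - exact/row_full_surjective.
  - rewrite imL; exists 1%:M; first exact: unitmx1.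
    by under eq_imagel do rewrite mulmx1; rewrite image_id.
  - rewrite imL hull_mulmx (_ : l%:R / 2 = mu) //.
    by apply/le_anti; rewrite mu_le andbT; exact: S1_proj_covers_ge cov.
move=> mu [f [surjf [B uB LB] mu_cov]]; move: mu_cov; rewrite LB.
move=> [_ lb].
move: LB; rewrite image_mulmx => LB.
(* [F] is the projection in coordinates of the basis [B] of the image lattice. It is integral
   because each unit vector is sent into that lattice. *)
pose F := lin1_mx f *m invmx B.
have Fint : F \is a mxOver Num.int.
  apply/mxOverP => i j; have : ([set x *m lin1_mx f | x in int_lattice R n])
      (delta_mx 0 i *m lin1_mx f).
    by exists (delta_mx 0 i) => // k; rewrite mxE rpred_nat.
  rewrite LB => -[x xint xE].
  have -> : F i j = (row i F) 0 j by rewrite [RHS]mxE.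
  by rewrite /F row_mul rowE -xE mulmxK //; exact: xint.
have fullF : row_full F.
  have /row_fullP[G GF] : row_full (lin1_mx f).
    apply/row_full_surjective; rewrite -surjf.
    by apply: eq_imagel => x _; rewrite mul_rV_lin1.
  apply/row_fullP; exists (B *m G).
  by rewrite /F mulmxA -(mulmxA B) GF mulmx1 mulmxV.
have [nu [[nu0 cov] _] nu_le] := S1_image_covering_radius bound Fint fullF.
apply: le_trans nu_le; apply: lb; split=> //.
rewrite image_mulmx hull_mulmx.
have := covers_mulmx uB cov; rewrite hull_mulmx.
by rewrite /F !mulmxA mulmxKV.
Qed.

(** The dimension [n] of the simplex depends on [P] through the multiplicities of its vertices, so
    the hypothesis ranges over every [n] at least [d]. *)
Lemma covering_minimum_polytope_bound d l (P : set 'rV[R]_l) :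
  (forall n, (d <= n)%N ->
     is_covering_minimum l (S1 R n) (int_lattice R n) (l%:R / 2)) ->
  lattice_polytope P -> non_hollow P ->
  exists2 mu : R, is_covering_radius P (int_lattice R l) mu & mu <= l%:R / 2.
Proof.
move=> covmin [polyP latP] [p [Pp pint]].
have [m [V [PE Vvert]]] := polytope_hull_vertices polyP.
rewrite {}PE in latP Pp Vvert *; set L := int_lattice R l.
pose V' := \matrix_i (row i V - p).
have V'E w : weights R m w -> w *m V' = w *m V - p.
  move=> [_ w1]; rewrite (_ : V' = V - const_mx 1 *m p); last first.
    by apply/matrixP => i j; rewrite !mxE big_ord1 !mxE mul1r.
  rewrite mulmxBr mulmxA (_ : w *m const_mx 1 = 1%:M) ?mul1mx //.
  apply/rowP => i; rewrite !mxE (ord1 i) eqxx -[RHS]w1.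
  by apply: eq_bigr => k _; rewrite mxE mulr1.
have hullV' x : hull V' x <-> hull V (x + p).
  split=> [[w ww <-]|[w ww wx]]; first by exists w; rewrite // V'E // subrK.
  by exists w; rewrite // V'E // wx addrK.
have V'int : V' \is a mxOver Num.int.
  apply/mxOverP => i j; rewrite !mxE rpredB //.
  by have := latP _ (Vvert i) j; rewrite mxE.
have int0 : (hull V')° 0.
  have [e e0 eV] := (interior_cubeP _ _).1 Pp.
  apply/interior_cubeP; exists e => // x xe; apply/hullV'; apply: eV => i.
  by have := xe i; rewrite !mxE subr0 addrK.
have [mu [[mu0 cov] lb]] := covering_radius_exists int0.
(* Translating by the lattice point [p] or by [- p] leaves the covering dilates unchanged, so [P]
   and its translate share the radius [mu]. *)
exists mu.
  split.
    by split=> //; apply: (covers_shift (p := p)) cov => // x /hullV'.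
  move=> nu [nu0 nucov]; apply: lb; split=> //.
  apply: (covers_shift (p := - p)) nucov => // x Vx.
  by apply/hullV'; rewrite subrK.
have m0 : (0 < m)%N.
  have [w [_ w1] _] := interior_subset int0.
  by case: (m) w w1 => // w /eqP; rewrite big_ord0 eq_sym oner_eq0.
have [e e0 eV] := (interior_cubeP _ _).1 int0.
(* A small negative multiple of the sum of the vertices lies in P - p, which
   gives a vanishing combination with all coefficients at least e'. *)
pose s : 'rV[R]_l := const_mx 1 *m V'; pose C := \sum_i `|s 0 i|.
have C0 : 0 <= C by exact: sumr_ge0.
have C10 : 0 < C + 1 by rewrite ltr_wpDl.
pose e' := e / (C + 1).
have e'0 : 0 < e' by rewrite divr_gt0.
have [|w [w0 _] wV] := eV (- (e' *: s)).
  move=> i; rewrite !mxE subr0 normrN normrM gtr0_norm // mulrAC.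
  rewrite ler_pdivrMr // ler_pM2l // (@le_trans _ _ C) ?lerDl //.
  by rewrite /C (bigD1 i) //= mxE lerDl sumr_ge0.
have [||a [a0 aV]] :=
    @positive_int_relation R m l V' (w + const_mx e') e' V'int e'0.
- by move=> i; rewrite !mxE lerDr.
- rewrite mulmxDl wV (_ : const_mx e' = e' *: const_mx 1) -?scalemxAl ?addNr //.
  by apply/matrixP => i j; rewrite !mxE mulr1.
have [n [g [dn gsurj gV]]] := repeat_rows d m0 a0 aV.
pose W := \matrix_k row (g k) V'; pose F := row' ord0 W.
have WE : S1_mx R n *m F = W.
  by apply: S1_mx_row'; rewrite -[RHS]gV; apply: eq_bigr => k _; rewrite rowK.
have Fint : F \is a mxOver Num.int.
  by apply/mxOverP => i j; rewrite 3!mxE; exact: (mxOverP V'int).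
have fullF : row_full F.
  (* Every row of [V'] occurs in [W], which factors through [F]; so the full row space of [V'] is
     contained in that of [F]. *)
  rewrite -sub1mx (@submx_trans _ _ _ _ _ _ V') //.
    by rewrite sub1mx; exact: hull_interior_row_full.
  apply/row_subP => i; have [k <-] := gsurj i.
  rewrite -(rowK (fun k => row (g k) V') k) (submx_trans (row_sub _ _)) //.
  by rewrite -/W -WE submxMl.
have latL := is_lattice_image Fint fullF.
have Wint0 : (hull W)° 0.
  by rewrite -WE; apply: hull_mulmx_interior0 => //; exact: S1_interior0.
have [nu nucov] := lattice_covering_radius_exists Wint0 latL.
(* The image simplex lies in the translated polytope and the image lattice in the integer lattice,
   so [mu <= nu]. Since [nu] is among the values whose maximum is l/2, the bound follows. *)
apply: (@le_trans _ _ nu).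
  have [[nu0 {}nucov] _] := nucov.
  apply: lb; split=> //; apply: (covers_shift (p := 0)) nucov.
    move=> x; rewrite addr0; apply: hull_sub => k.
    by rewrite rowK; exact: hull_row.
  by move=> _ [x xint <-]; exact: int_lattice_mulmx.
have [_] := covmin n dn; apply; exists (mulmxr F); split=> //=.
  exact/row_full_surjective.
by rewrite S1_hull hull_mulmx WE.
Qed.

End Equivalence.

Theorem theorem1p2 (R : realType) (d : nat) :
  (forall (l : nat) (P : set 'rV[R]_l), (l <= d)%N ->
     lattice_polytope P -> non_hollow P ->
     exists2 mu : R, is_covering_radius P (int_lattice R l) mu & mu <= l%:R / 2)
  <->
  (forall l n : nat, (l <= d)%N -> (d <= n)%N ->
     is_covering_minimum l (S1 R n) (int_lattice R n) (l%:R / 2)).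
Proof.
split=> [bound l n ld dn|covmin l P ld].
  apply: polytope_bound_covering_minimum; last exact: leq_trans dn.
  by move=> P; exact: bound.
by apply: (@covering_minimum_polytope_bound R d) => n; exact: covmin.
Qed.
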